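(* Let $\mathcal{C}$ be a nondegenerate $[n,k]_{q^m/q}$ code and let $\mathcal{U}$ be any corresponding $[n,k]_{q^m/q}$ system. Then $$\ell(\mathcal{U})=k-\min\{r\in\{0,1,\dots,k\}: d^{\mathrm{rk}}_r(\mathcal{C})=n-(k-r)m\}.$$
   Context: Let $q$ be a prime power and $n,m,k$ positive integers. For $v\in\mathbb{F}_{q^m}^n$ and an ordered basis $\Gamma=(\gamma_1,\dots,\gamma_m)$ of $\mathbb{F}_{q^m}$ over $\mathbb{F}_q$, let $\Gamma(v)\in\mathbb{F}_q^{n\times m}$ be the matrix with $v_i=\sum_{j}\Gamma(v)_{ij}\gamma_j$. The rank support $\sigma^{\mathrm{rk}}(v)\subseteq\mathbb{F}_q^n$ is the column space of $\Gamma(v)$ (independent of $\Gamma$). An $[n,k]_{q^m/q}$ code is a $k$-dimensional $\mathbb{F}_{q^m}$-subspace $\mathcal{C}\subseteq\mathbb{F}_{q^m}^n$; it is nondegenerate if $\sum_{v\in\mathcal{C}}\sigma^{\mathrm{rk}}(v)=\mathbb{F}_q^n$. An $[n,k]_{q^m/q}$ system is an $n$-dimensional $\mathbb{F}_q$-subspace $\mathcal{U}\subseteq\mathbb{F}_{q^m}^k$ with $\langle\mathcal{U}\rangle_{\mathbb{F}_{q^m}}=\mathbb{F}_{q^m}^k$. A system corresponding to a nondegenerate code $\mathcal{C}$ is the $\mathbb{F}_q$-span of the columns of a generator matrix $G\in\mathbb{F}_{q^m}^{k\times n}$ of $\mathcal{C}$. The linearity index of $\mathcal{U}$ is $\ell(\mathcal{U})=\max\{\dim_{\mathbb{F}_{q^m}}(H):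 H\subseteq\mathbb{F}_{q^m}^k \text{ an } \mathbb{F}_{q^m}\text{-subspace with } H\subseteq\mathcal{U}\}$. Let $\theta$ be the map $x\mapsto x^q$ applied componentwise to $\mathbb{F}_{q^m}^n$, and let $\Lambda_q(n,m)$ be the set of $\mathbb{F}_{q^m}$-subspaces $\mathcal{V}\le\mathbb{F}_{q^m}^n$ with $\theta(\mathcal{V})=\mathcal{V}$. For $1\le r\le k$, the $r$-th generalized rank weight is $d^{\mathrm{rk}}_r(\mathcal{C})=\min\{\dim_{\mathbb{F}_{q^m}}(\mathcal{V}):\mathcal{V}\in\Lambda_q(n,m),\ \dim_{\mathbb{F}_{q^m}}(\mathcal{V}\cap\mathcal{C})\ge r\}$, and $d^{\mathrm{rk}}_0(\mathcal{C})=0$. *)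

(* Defs.v *)
From HB Require Import structures.
From mathcomp Require Import all_boot all_order all_algebra all_field.
From mathcomp Require Import boolp classical_sets.

Set Implicit Arguments.
Unset Strict Implicit.
Unset Printing Implicit Defensive.

Import GRing.Theory.
Local Open Scope ring_scope.

(* F_q is F : finFieldType with q = #|F|, and F_{q^m} is L : fieldExtType F
   with \dim {:L} = m.  L-subspaces of L^n are {vspace 'rV[L]_n} (or
   {vspace 'cV[L]_k}); matrices carry no vector space structure over the
   subfield F, so F-subspaces of L^k are {vspace {ffun 'I_k -> L}}, whose \dim
   is the dimension over F. *)

Section RankMetric.
Variables (F : finFieldType) (L : fieldExtType F).

Definition gamma_mx m (b : m.-tuple L) n (v : 'rV[L]_n) : 'M[F]_(n, m) :=
  \matrix_(i, j) coord b j (v 0 i).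

Definition rank_support_in m (b : m.-tuple L) n (v : 'rV[L]_n) :
    {vspace 'cV[F]_n} :=
  <<[seq col j (gamma_mx b v) | j : 'I_m]>>%VS.

(* The choice of basis is immaterial, see rank_supportE. *)
Definition rank_support n (v : 'rV[L]_n) : {vspace 'cV[F]_n} :=
  rank_support_in (vbasis {:L}) v.

(* finvect_type L is L seen as a finite type, so that v ranges over the
   finitely many vectors of L^n. *)
Definition rank_nondegenerate n (C : {vspace 'rV[L]_n}) : Prop :=
  (\sum_(v : 'rV[finvect_type L]_n | (v : 'rV[L]_n) \in C)
     rank_support v)%VS = fullv.

Definition generator_matrix k n (C : {vspace 'rV[L]_n}) (G : 'M[L]_(k, n)) :
    Prop :=
  basis_of C [seq row i G | i : 'I_k].

Definition col_system k n (G : 'M[L]_(k, n)) : {vspace {ffun 'I_k -> L}} :=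
  <<[seq [ffun i => G i j] | j : 'I_n]>>%VS.

Definition corresponding_system k n (C : {vspace 'rV[L]_n})
    (U : {vspace {ffun 'I_k -> L}}) : Prop :=
  exists2 G : 'M[L]_(k, n), generator_matrix C G & U = col_system G.

Definition is_system n k (U : {vspace {ffun 'I_k -> L}}) : Prop :=
  \dim U = n /\
  <<[seq (\col_i u i : 'cV[L]_k) | u : finvect_type {ffun 'I_k -> L} in U]>>%VS
    = fullv.

Definition contained_in k (H : {vspace 'cV[L]_k})
    (U : {vspace {ffun 'I_k -> L}}) : Prop :=
  forall x : 'cV[L]_k, x \in H -> [ffun i => x i 0] \in U.

Definition linearity_index k (U : {vspace {ffun 'I_k -> L}}) : nat :=
  (\max_(d < k.+1 |
     `[< exists2 H : {vspace 'cV[L]_k}, contained_in H U & \dim H = d >]) d)%N.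

Definition theta n (v : 'rV[L]_n) : 'rV[L]_n := map_mx (fun x => x ^+ #|F|) v.

Definition theta_stable n (V : {vspace 'rV[L]_n}) : Prop :=
  ([set theta v | v in [set` V]] = [set` V])%classic.

(* For 1 <= r <= \dim C the minimum is over a nonempty set containing n (take
   V = fullv), so the default value n of the iterated minimum is harmless. *)
Definition gen_rank_weight n (C : {vspace 'rV[L]_n}) (r : nat) : nat :=
  if r is 0%N then 0%N else
  \big[minn/n]_(d < n.+1 |
    `[< exists V : {vspace 'rV[L]_n},
          [/\ theta_stable V, (r <= \dim (V :&: C))%N & \dim V = d] >]) d.

Definition is_least (P : nat -> Prop) (r : nat) : Prop :=
  P r /\ forall s, P s -> (r <= s)%N.

Lemma rank_support_in_sub m (b : m.-tuple L) m' (b' : m'.-tuple L) n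
    (v : 'rV[L]_n) :
  basis_of {:L} b -> basis_of {:L} b' ->
  (rank_support_in b' v <= rank_support_in b v)%VS.
Proof.
move=> bb bb'; apply/span_subvP => w /mapP[j _ ->].
have -> : col j (gamma_mx b' v) =
    \sum_(l < m) coord b' j b`_l *: col l (gamma_mx b v).
  apply/matrixP => i z; rewrite summxE !mxE.
  rewrite {1}(coord_basis bb (memvf (v 0 i))) linear_sum /=.
  by apply: eq_bigr => l _; rewrite !mxE linearZ /= mulrC.
by apply: rpred_sum => l _; apply/rpredZ/memv_span/map_f; rewrite mem_enum.
Qed.

Lemma rank_supportE m (b : m.-tuple L) n (v : 'rV[L]_n) :
  basis_of {:L} b -> rank_support_in b v = rank_support v.
Proof.
have bL := vbasisP {:L}; move=> bb; apply: subv_anti.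
by rewrite !rank_support_in_sub.
Qed.

Lemma free_familyP (K : fieldType) (vT : vectType K) n (f : 'I_n -> vT) :
  free [seq f j | j : 'I_n] <->
  (forall a : 'I_n -> K, \sum_j a j *: f j = 0 -> forall j, a j = 0).
Proof.
have -> : [seq f j | j : 'I_n] = [tuple f j | j < n] by [].
have E (a : 'I_n -> K) :
    \sum_j a j *: [tuple f j | j < n]`_j = \sum_j a j *: f j.
  by apply: eq_bigr => j _; rewrite -tnth_nth tnth_mktuple.
split=> [/freeP fP a|fP]; first by rewrite -E; apply: fP.
by apply/freeP => a; rewrite E; apply: fP.
Qed.

Lemma corresponding_systemP k n (C : {vspace 'rV[L]_n})
    (U : {vspace {ffun 'I_k -> L}}) :
  rank_nondegenerate C -> corresponding_system C U -> is_system n U.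
Proof.
move=> ndC [G /andP[/eqP spanG freeG] ->]; split; last first.
  have rfG : row_free G.
    apply: inj_row_free => c cG0; apply/rowP => i; rewrite mxE.
    move/free_familyP: freeG => /(_ (fun j => c 0 j)); apply.
    by rewrite -mulmx_sum_row.
  apply/eqP; rewrite eqEsubv subvf /=; apply/subvP => x _.
  rewrite -[x]mul1mx -(mulmxVp rfG) -mulmxA.
  set y := pinvmx G *m x.
  have -> : G *m y = \sum_j y j 0 *: col j G.
    apply/matrixP => i z; rewrite (ord1 z) summxE !mxE.
    by apply: eq_bigr => j _; rewrite !mxE mulrC.
  apply: rpred_sum => j _; apply/rpredZ/memv_span.
  have -> : col j G = \col_i [ffun i => G i j] i.
    by apply/matrixP => i z; rewrite !mxE ffunE.
  apply/mapP; exists [ffun i => G i j] => //.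
  rewrite (@mem_enum (finvect_type {ffun 'I_k -> L})).
  by apply/memv_span/map_f; rewrite mem_enum.
suff /eqP -> : free [seq [ffun i => G i j] | j : 'I_n].
  by rewrite size_map -cardE card_ord.
apply/free_familyP => a aG0 j.
pose ev (w : 'cV[F]_n) : F := \sum_j a j * w j 0.
have evP (b : F) : {morph ev : u v / b *: u + v >-> b * u + v}.
  move=> u v; rewrite /ev mulr_sumr -big_split /=.
  by apply: eq_bigr => l _; rewrite !mxE mulrDr mulrCA.
pose evL := GRing.isLinear.Build F 'cV[F]_n F^o _ ev evP.
pose evl : {linear 'cV[F]_n -> F^o} := HB.pack ev evL.
suff: (fullv <= lker (linfun evl))%VS.
  move/subvP/(_ (delta_mx j 0) (memvf _)); rewrite memv_ker lfunE /= => /eqP.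
  rewrite /ev (bigD1 j) //= big1 => [|l lj]; rewrite mxE ?(negPf lj) ?mulr0 //.
  by rewrite !eqxx addr0 mulr1.
rewrite -ndC; apply/subv_sumP => v vC.
apply/span_subvP => w /mapP[l _ ->]; rewrite memv_ker lfunE /= /ev.
pose c : 'cV[L]_n := \col_i (a i)%:A.
have cE (x : 'rV[L]_n) : (x *m c) 0 0 = \sum_i a i *: x 0 i.
  by rewrite mxE; apply: eq_bigr => i _; rewrite mxE mulr_algr.
have {vC} av0 : \sum_i a i *: (v 0 i : L) = 0.
  suff: (C <= lker (linfun (mulmxr c : 'rV[L]_n -> 'rV[L]_1)))%VS.
    by move/subvP/(_ _ vC); rewrite memv_ker lfunE /= -cE => /eqP ->; rewrite mxE.
  rewrite -spanG; apply/span_subvP => _ /mapP[i _ ->].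
  rewrite memv_ker lfunE /=; apply/eqP/matrixP => z z'.
  rewrite (ord1 z) (ord1 z') cE mxE.
  have /ffunP/(_ i) := aG0; rewrite !ffunE sum_ffunE => E.
  by rewrite -[RHS]E; apply: eq_bigr => t _; rewrite !ffunE mxE.
apply/eqP; transitivity (coord (vbasis {:L}) l (\sum_i a i *: (v 0 i : L))).
  by rewrite linear_sum; apply: eq_bigr => i _; rewrite !mxE linearZ.
by rewrite av0 linear0.
Qed.
End RankMetric.

(* Main.v *)
(* Theta-stable spaces V are the L-spans of F-subspaces of F^n, so V is
   determined by its annihilator W in F^n, with dim_F W = n - dim_L V.  For a
   generator matrix G, w |-> G w is an isomorphism from F^n to the system U, and
   it sends W into the annihilator H of {x | x G in V}, whose dimension is
   k - dim (V :&: C).  Hence n - d_r(C) is the largest dim_F (H :&: U) with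
   dim_L H <= k - r, which is at most (k - r) m, with equality exactly when some
   H of dimension k - r is contained in U. *)
Require Import Defs.
From HB Require Import structures.
From mathcomp Require Import all_boot all_order all_algebra all_field.
From mathcomp Require Import boolp classical_sets zify.

Set Implicit Arguments.
Unset Strict Implicit.
Unset Printing Implicit Defensive.

Import GRing.Theory.
Local Open Scope ring_scope.

(** * Row and column spaces of matrices as vector subspaces *)

Section MatrixSpaces.
Variable K : fieldType.

Lemma dim_rV n : \dim {:'rV[K]_n} = n.
Proof. by rewrite dimvf /dim /= mul1n. Qed.

Lemma dim_cV n : \dim {:'cV[K]_n} = n.
Proof. by rewrite dimvf /dim /= muln1. Qed.

Lemma dim_rV_le n (V : {vspace 'rV[K]_n}) : (\dim V <= n)%N.
Proof. by rewrite -[leqRHS]dim_rV dimvS ?subvf. Qed.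

Lemma dim_cV_le n (V : {vspace 'cV[K]_n}) : (\dim V <= n)%N.
Proof. by rewrite -[leqRHS]dim_cV dimvS ?subvf. Qed.

Definition rowvs m n (A : 'M[K]_(m, n)) : {vspace 'rV[K]_n} :=
  limg (linfun (mulmxr A : 'rV_m -> 'rV_n)).

Definition colvs m n (A : 'M[K]_(m, n)) : {vspace 'cV[K]_m} :=
  limg (linfun (mulmx A : 'cV_n -> 'cV_m)).

Lemma rowvsP m n (A : 'M[K]_(m, n)) v : (v \in rowvs A) = (v <= A)%MS.
Proof.
apply/memv_imgP/submxP => [[u _ ->]|[u ->]]; exists u; rewrite ?memvf //.
  by rewrite lfunE.
by rewrite lfunE.
Qed.

Lemma eq_rowvs m1 m2 n (A : 'M[K]_(m1, n)) (B : 'M[K]_(m2, n)) :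
  (A :=: B)%MS -> rowvs A = rowvs B.
Proof. by move=> eAB; apply/vspaceP => v; rewrite !rowvsP eAB. Qed.

Lemma dim_rowvs m n (A : 'M[K]_(m, n)) : \dim (rowvs A) = \rank A.
Proof.
(* With a row basis in place of [A], the map [u |-> u A] is injective, so its image has as many
   dimensions as there are rows. *)
rewrite -(eq_rowvs (eq_row_base A)) limg_dim_eq ?dim_rV //.
apply/eqP; rewrite -subv0; apply/subvP => u.
rewrite memv_cap memv_ker lfunE memv0 /= => /andP[_ /eqP uA0].
by apply/eqP/(row_free_inj (row_base_free A)); rewrite uA0 mul0mx.
Qed.

Lemma rowvs_span m n (A : 'M[K]_(m, n)) :
  <<[seq row i A | i : 'I_m]>>%VS = rowvs A.
Proof.
apply: subv_anti; apply/andP; split.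
  by apply/span_subvP => _ /mapP[i _ ->]; rewrite rowvsP row_sub.
apply/subvP => v; rewrite rowvsP => /submxP[u ->]; rewrite mulmx_sum_row.
by apply: rpred_sum => i _; apply/rpredZ/memv_span/map_f; rewrite mem_enum.
Qed.

Lemma rowvs_base n (V : {vspace 'rV[K]_n}) :
  exists2 A : 'M[K]_(\dim V, n), V = rowvs A & row_free A.
Proof.
have E : V = rowvs (\matrix_(i < \dim V) (vbasis V)`_i).
  rewrite -{1}(span_basis (vbasisP V)) -rowvs_span; congr <<_>>%VS.
  apply: (@eq_from_nth _ 0) => [|i]; rewrite size_tuple.
    by rewrite size_map size_enum_ord.
  move=> lti; rewrite (nth_map (Ordinal lti)) ?size_enum_ord //.
  by rewrite rowK nth_enum_ord.
exists (\matrix_(i < \dim V) (vbasis V)`_i) => //.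
by rewrite /row_free -dim_rowvs -E.
Qed.

Lemma colvsP m n (A : 'M[K]_(m, n)) v :
  (v \in colvs A) <-> exists u, v = A *m u.
Proof.
split=> [/memv_imgP[u _ ->]|[u ->]]; first by exists u; rewrite lfunE.
by apply/memv_imgP; exists u; rewrite ?memvf ?lfunE.
Qed.

(** Transposition is injective and linear, and carries the row space of [A^T] onto [colvs A]. *)
Lemma dim_colvs m n (A : 'M[K]_(m, n)) : \dim (colvs A) = \rank A.
Proof.
rewrite -mxrank_tr -dim_rowvs.
have trL : lker (linfun (trmx : 'rV[K]_m -> 'cV[K]_m)) == 0%VS.
  by apply/lker0P => u v; rewrite !lfunE => /trmx_inj.
rewrite -(limg_dim_eq (U := rowvs A^T) (f := linfun trmx)); last first.
  by rewrite (eqP trL) capv0.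
congr (\dim _); apply/vspaceP => v; apply/idP/memv_imgP.
  move/colvsP => [u ->]; exists (A *m u)^T; last by rewrite lfunE /= trmxK.
  by rewrite rowvsP trmx_mul submxMl.
case=> w; rewrite rowvsP lfunE => /submxP[u ->] ->; apply/colvsP.
by exists u^T; rewrite /= trmx_mul trmxK.
Qed.

Lemma colvs_base m (V : {vspace 'cV[K]_m}) :
  exists2 A : 'M[K]_(m, \dim V), V = colvs A & row_free A^T.
Proof.
pose A : 'M[K]_(m, \dim V) := \matrix_(i, j) (vbasis V)`_j i 0.
have colA j : col j A = (vbasis V)`_j.
  by apply/matrixP => i z; rewrite !mxE (ord1 z).
have AE u : A *m u = \sum_j u j 0 *: (vbasis V)`_j.
  apply/matrixP => i z; rewrite (ord1 z) summxE !mxE.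
  by apply: eq_bigr => j _; rewrite !mxE mulrC.
have E : V = colvs A.
  apply/vspaceP => v; apply/idP/idP => [vV|/colvsP[u ->]].
    apply/colvsP; exists (\col_j coord (vbasis V) j v).
    rewrite AE {1}(coord_vbasis vV).
    by apply: eq_bigr => j _; rewrite mxE.
  rewrite AE; apply: rpred_sum => j _; apply/rpredZ/vbasis_mem/mem_nth.
  by rewrite size_tuple.
by exists A => //; rewrite /row_free mxrank_tr -dim_colvs -E.
Qed.

Lemma rowvs_cap m1 m2 n (A : 'M[K]_(m1, n)) (B : 'M[K]_(m2, n)) :
  (rowvs A :&: rowvs B)%VS = rowvs (A :&: B)%MS.
Proof. by apply/vspaceP => v; rewrite memv_cap !rowvsP sub_capmx. Qed.

End MatrixSpaces.

Section RankMetric.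
Variables (F : finFieldType) (L : fieldExtType F).

(** * [F]-linear maps into [L^k] and restriction of scalars *)

Definition ffun_mulmx k n (A : 'M[L]_(k, n)) (c : {ffun 'I_n -> L}) :
  {ffun 'I_k -> L} := [ffun i => \sum_j A i j * c j].

Fact ffun_mulmx_linear k n (A : 'M[L]_(k, n)) : linear (ffun_mulmx A).
Proof.
move=> a u v; apply/ffunP => i; rewrite !ffunE scaler_sumr -big_split.
by apply: eq_bigr => j _; rewrite !ffunE mulrDr scalerAr.
Qed.

HB.instance Definition _ k n (A : 'M[L]_(k, n)) :=
  GRing.isLinear.Build F {ffun 'I_n -> L} {ffun 'I_k -> L} _
    (ffun_mulmx A) (ffun_mulmx_linear A).

Definition ffun_ext n (w : 'cV[F]_n) : {ffun 'I_n -> L} :=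
  [ffun j => (w j 0)%:A].

Fact ffun_ext_linear n : linear (@ffun_ext n).
Proof.
by move=> a u v; apply/ffunP => i; rewrite !ffunE !mxE scalerDl scalerA.
Qed.

HB.instance Definition _ n :=
  GRing.isLinear.Build F 'cV[F]_n {ffun 'I_n -> L} _
    (@ffun_ext n) (@ffun_ext_linear n).

Definition colmap k n (G : 'M[L]_(k, n)) : 'Hom('cV[F]_n, {ffun 'I_k -> L}) :=
  (linfun (ffun_mulmx G) \o linfun (@ffun_ext n))%VF.

Lemma colmapE k n (G : 'M[L]_(k, n)) w :
  \col_i colmap G w i = G *m map_mx (in_alg L) w.
Proof.
apply/matrixP => i z; rewrite (ord1 z) !mxE comp_lfunE !lfunE ffunE.
by apply: eq_bigr => j _; rewrite ffunE mxE.
Qed.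

Lemma limg_colmap k n (G : 'M[L]_(k, n)) : limg (colmap G) = col_system G.
Proof.
have E w : colmap G w = \sum_j w j 0 *: [ffun i => G i j].
  rewrite comp_lfunE !lfunE; apply/ffunP => i; rewrite !ffunE sum_ffunE.
  by apply: eq_bigr => j _; rewrite !ffunE mulr_algr.
apply: subv_anti; apply/andP; split.
  apply/subvP => _ /memv_imgP[w _ ->]; rewrite E.
  by apply: rpred_sum => j _; apply/rpredZ/memv_span/map_f; rewrite mem_enum.
apply/span_subvP => _ /mapP[j _ ->]; apply/memv_imgP.
exists (delta_mx j 0); rewrite ?memvf // E (bigD1 j) //= mxE !eqxx scale1r.
by rewrite big1 ?addr0 // => l lj; rewrite mxE (negPf lj) scale0r.
Qed.

(** [H] seen as an [F]-space, built as the image of the [F]-linear map [c |-> A c] for a matrix [A]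
    whose columns form a basis of [H]. By [mem_restrict_scalars] the choice of [A] is immaterial. *)
Definition restrict_scalars k (H : {vspace 'cV[L]_k}) :
    {vspace {ffun 'I_k -> L}} :=
  limg (linfun (ffun_mulmx (s2val (cid2 (colvs_base H))))).

Lemma mem_restrict_scalars k (H : {vspace 'cV[L]_k}) u :
  (u \in restrict_scalars H) = (\col_i u i \in H).
Proof.
rewrite /restrict_scalars; case: cid2 => A /= HA _.
transitivity (\col_i u i \in colvs A); last by rewrite -HA.
apply/memv_imgP/idP => [[c _ ->]|/colvsP[c uA]].
  apply/colvsP; exists (\col_j c j); apply/matrixP => i z.
  rewrite lfunE !mxE ffunE.
  by apply: eq_bigr => j _; rewrite mxE.
exists [ffun j => c j 0]; rewrite ?memvf // lfunE; apply/ffunP => i.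
move/matrixP/(_ i 0): uA; rewrite !mxE ffunE => ->.
by apply: eq_bigr => j _; rewrite ffunE.
Qed.

(** The columns of [A] are independent over [L], so [c |-> A c] is injective on [L^(\dim H)]. *)
Lemma dim_restrict_scalars k (H : {vspace 'cV[L]_k}) :
  \dim (restrict_scalars H) = (\dim H * \dim {:L})%N.
Proof.
rewrite /restrict_scalars; case: cid2 => A /= HA freeA.
rewrite limg_dim_eq; first by rewrite !dimvf /= /dim /= card_ord.
apply/eqP; rewrite -subv0; apply/subvP => c.
rewrite memv_cap memv_ker lfunE memv0 /= => /andP[_ /eqP Ac0].
have /rowP c0 : \row_j c j = 0.
  apply: (row_free_inj freeA); rewrite mul0mx; apply/rowP => i.
  move/ffunP/(_ i): Ac0; rewrite !mxE !ffunE => Aci; rewrite -[RHS]Aci.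
  by apply: eq_bigr => j _; rewrite !mxE mulrC.
by apply/eqP/ffunP => j; move: (c0 j); rewrite !mxE ffunE.
Qed.

Lemma contained_inE k (H : {vspace 'cV[L]_k}) (U : {vspace {ffun 'I_k -> L}}) :
  contained_in H U <-> (restrict_scalars H <= U)%VS.
Proof.
split=> [HU|/subvP HU x xH].
  apply/subvP => u; rewrite mem_restrict_scalars => /HU.
  suff -> : [ffun i => (\col_i u i) i 0] = u by [].
  by apply/ffunP => i; rewrite ffunE mxE.
apply: HU; rewrite mem_restrict_scalars.
suff -> : \col_i [ffun i => x i 0] i = x by [].
by apply/matrixP => i z; rewrite mxE ffunE (ord1 z).
Qed.

(** * The q-power Frobenius and theta-stable subspaces *)

Lemma card_finfield_neq0 : #|F| != 0%N.
Proof. by rewrite -lt0n ltnW ?finNzRing_gt1. Qed.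

(** With q = [#|F|] a power of the characteristic, [x |-> x^q] is additive, and it fixes the scalars
    in [F]. *)
Lemma expr_card_finfield_linear (a : F) (x y : L) :
  (a *: x + y) ^+ #|F| = a *: x ^+ #|F| + y ^+ #|F|.
Proof.
have [p p_pr pcharF] := finPcharP F.
have natF : [pchar L].-nat #|F|.
  rewrite (card_pprimeChar pcharF : #|F| = _) pnatX (pnatE _ p_pr).
  by rewrite pchar_lalg pcharF.
by rewrite exprDn_pchar // exprZn expf_card.
Qed.

Lemma expr_card_finfield_sum n (a : 'I_n -> F) (x : 'I_n -> L) :
  (\sum_i a i *: x i) ^+ #|F| = \sum_i a i *: x i ^+ #|F|.
Proof.
apply: (big_rec2 (fun u v => u ^+ #|F| = v)) => [|i u _ _ <-].
  by rewrite expr0n (negPf card_finfield_neq0).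
exact: expr_card_finfield_linear.
Qed.

(** Some power of [theta] is the identity: with [m = \dim {:L}], [x^(q^m) = x] on [L]. So [v] is the
    image of the [(m-1)]-st iterate, which stays in [V]. *)
Lemma theta_stable_sub n (V : {vspace 'rV[L]_n}) :
  (forall v, v \in V -> theta v \in V) -> theta_stable V.
Proof.
move=> thV; apply/seteqP; split=> v /=; first by case=> w wV <-; apply: thV.
move=> vV; have iterV i : iter i (@theta F L n) v \in V.
  by elim: i => //= i; apply: thV.
have iterE i : iter i (@theta F L n) v = map_mx (fun x => x ^+ (#|F| ^ i)) v.
  elim: i => [|i /= ->]; apply/rowP => j; rewrite !mxE ?expn0 ?expr1 //.
  by rewrite -exprM expnSr.
exists (iter (\dim {:L}).-1 (@theta F L n) v) => //.
rewrite -[theta _]/(iter (\dim {:L}).-1.+1 (@theta F L n) v).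
rewrite prednK ?adim_gt0 // iterE; apply/rowP => j; rewrite mxE.
by apply/eqP; rewrite -(Fermat's_little_theorem {:L}%AS) memvf.
Qed.

(* Frobenius sends the basis matrix of a stable space that is the identity on
   some maximal set of independent columns to another one, hence fixes it. *)
Lemma theta_stable_descent n (V : {vspace 'rV[L]_n}) :
  theta_stable V ->
  exists2 M : 'M[F]_(\dim V, n), V = rowvs (map_mx (in_alg L) M) & row_free M.
Proof.
move=> stV; have [A VA freeA] := rowvs_base V.
have fullAT : row_full A^T by rewrite /row_full mxrank_tr.
pose f := fullrankfun fullAT; pose P := colsub f A.
have unitP : P \in unitmx.
  by rewrite -unitmx_tr -row_full_unit trmx_mxsub fullrowsub_full.
have [B eBA fB] : exists2 B, (B :=: A)%MS & colsub f B = 1%:M.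
  exists (invmx P *m A); last by rewrite -mulmx_colsub mulVmx.
  by apply/eqmxMfull; rewrite row_full_unit unitmx_inv.
pose B' := map_mx (fun x => x ^+ #|F|) B.
have fB' : colsub f B' = 1%:M.
  apply/matrixP => i j; move/matrixP/(_ i j): fB; rewrite !mxE => ->.
  by case: eqP => _; rewrite ?expr1n // expr0n (negPf card_finfield_neq0).
(* Stability puts the rows of [B'] back in [V]; comparing both sides on the columns [f] then forces
   [X = 1]. *)
have [X B'X] : exists X, B' = X *m B.
  have inV v : (v \in V) = (v <= B)%MS.
    by transitivity (v \in rowvs A); [rewrite -VA | rewrite rowvsP eBA].
  apply/submxP/row_subP => i; rewrite -inV.
  have BV : row i B \in V by rewrite inV row_sub.
  have : [set theta v | v in [set` V]]%classic (theta (row i B)).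
    by exists (row i B).
  by rewrite stV /= /theta -map_row.
have B'B : B' = B.
  by move: fB'; rewrite B'X -mulmx_colsub fB mulmx1 => ->; rewrite mul1mx.
(* The entries satisfy [x^q = x], which characterizes the one-dimensional subfield [1%VS], the copy
   of [F] in [L]. *)
have inF i j : {a : F | B i j = a%:A}.
  apply/cid; have /vlineP[a ->] : B i j \in 1%VS; last by exists a.
  rewrite (Fermat's_little_theorem 1%AS) dimv1 expn1; apply/eqP.
  by move/matrixP/(_ i j): B'B; rewrite mxE.
have BM : B = map_mx (in_alg L) (\matrix_(i, j) sval (inF i j)).
  by apply/matrixP => i j; rewrite !mxE; case: (inF i j).
exists (\matrix_(i, j) sval (inF i j)); first by rewrite -BM (eq_rowvs eBA).
by rewrite /row_free -(mxrank_map (in_alg L)) -BM eBA.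
Qed.

(** Since [M] has entries in [F], raising the equations [v M = 0] to the q-th power gives
    [theta v M = 0]. *)
Lemma theta_stable_annihilator n d (M : 'M[F]_(n, d)) :
  theta_stable (rowvs (kermx (map_mx (in_alg L) M))).
Proof.
apply: theta_stable_sub => v; rewrite !rowvsP !sub_kermx => /eqP vM0.
apply/eqP/rowP => j; move/rowP/(_ j)/(congr1 (fun x => x ^+ #|F|)): vM0.
rewrite !mxE expr0n (negPf card_finfield_neq0) => vM0; rewrite -[RHS]vM0.
under eq_bigr do rewrite !mxE mulr_algr.
under [in RHS]eq_bigr do rewrite !mxE mulr_algr.
by rewrite expr_card_finfield_sum.
Qed.

Lemma theta_stable_fullv n : theta_stable (fullv : {vspace 'rV[L]_n}).
Proof. by apply: theta_stable_sub => v _; apply: memvf. Qed.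

(** * Generalized rank weights as attained minima *)

Lemma gen_rank_weight_le n (C V : {vspace 'rV[L]_n}) r :
  theta_stable V -> (r <= \dim (V :&: C))%N ->
  (gen_rank_weight C r <= \dim V)%N.
Proof.
case: r => [//|r] stV rV; rewrite /gen_rank_weight -Order.NatOrder.minEnat.
have ltV : (\dim V < n.+1)%N by apply: dim_rV_le.
apply: (Order.TotalTheory.bigmin_le_cond (T := nat) n (j := Ordinal ltV) val).
by apply/asboolP; exists V.
Qed.

Lemma gen_rank_weight_attained n (C : {vspace 'rV[L]_n}) r :
  (r <= \dim C)%N ->
  exists V : {vspace 'rV[L]_n},
    [/\ theta_stable V, (r <= \dim (V :&: C))%N & \dim V = gen_rank_weight C r].
Proof.
case: r => [_|r rC].
  exists 0%VS; split; rewrite ?dimv0 //; apply: theta_stable_sub => v.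
  rewrite !memv0 => /eqP ->; apply/eqP/rowP => j; rewrite !mxE expr0n.
  by rewrite (negPf card_finfield_neq0).
rewrite /gen_rank_weight; apply: (@big_ind _ (fun d => exists V,
  [/\ theta_stable V, (r < \dim (V :&: C))%N & \dim V = d])).
(* The default value [n] of the minimum is itself attained, by the whole space. *)
- exists fullv; split; first exact: theta_stable_fullv.
    by rewrite (capv_idPr (subvf C)).
  exact: dim_rV.
- by move=> d e Pd Pe; rewrite /minn; case: ifP.
- by move=> d /asboolP.
Qed.

(** * Duality between theta-stable subspaces of [L^n] and subspaces of [L^k] *)

Section Duality.
Variables (n k : nat) (C : {vspace 'rV[L]_n}) (G : 'M[L]_(k, n)).
Hypotheses (CG : C = rowvs G) (freeG : row_free G).
Hypothesis injG : lker (colmap G) == 0%VS.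

(** [V] is spanned by a matrix [M] over [F], whose solution space [W] in [F^n] has dimension
    [n - \dim V]. If [M w = 0], then every [x] with [x G] in [V] kills [G w], so [colmap G] embeds
    [W] into the annihilator [H] of these [x]. *)
Lemma stable_space_dual (V : {vspace 'rV[L]_n}) : theta_stable V ->
  exists2 H : {vspace 'cV[L]_k}, (\dim H + \dim (V :&: C) = k)%N &
    (n - \dim V <= \dim (restrict_scalars H :&: limg (colmap G)))%N.
Proof.
move=> /theta_stable_descent[M VM freeM].
set ML := map_mx (in_alg L) M in VM.
set N := (ML :&: G)%MS.
have dimN : \dim (V :&: C) = \rank N by rewrite {1}VM CG rowvs_cap dim_rowvs.
(* The rows of [Y] are the coordinates of those of [N] in the basis [G]; they span all [x] with
   [x G] in [V]. *)
pose Y := N *m pinvmx G.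
have YG : Y *m G = N by rewrite mulmxKpV ?capmxSr.
have rankY : \rank Y = \rank N by rewrite -YG mxrankMfree.
exists (colvs (kermx Y^T)^T).
  rewrite dim_colvs mxrank_tr mxrank_ker mxrank_tr dimN rankY subnK //.
  by rewrite -rankY rank_leq_col.
pose W := colvs (kermx M^T)^T.
have dimW : \dim W = (n - \dim V)%N.
  by rewrite dim_colvs mxrank_tr mxrank_ker mxrank_tr (eqP freeM).
rewrite -dimW -(limg_dim_eq (U := W) (f := colmap G)) ?(eqP injG) ?capv0 //.
apply/dimvS/subvP => _ /memv_imgP[w wW ->].
rewrite memv_cap memv_img ?memvf // andbT mem_restrict_scalars colmapE.
have Mw : M *m w = 0.
  move/colvsP: wW => [u ->]; rewrite mulmxA -[M]trmxK -trmx_mul.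
  by rewrite trmxK mulmx_ker trmx0 mul0mx.
have Yw : Y *m (G *m map_mx (in_alg L) w) = 0.
  rewrite mulmxA YG; have /submxP[Z ->] : (N <= ML)%MS by apply: capmxSl.
  by rewrite -mulmxA -map_mxM Mw map_mx0 mulmx0.
apply/colvsP.
have /submxP[u uE] : ((G *m map_mx (in_alg L) w)^T <= kermx Y^T)%MS.
  by rewrite sub_kermx -trmx_mul Yw trmx0.
by exists u^T; rewrite -trmx_mul -uE trmxK.
Qed.

(** [V] is the annihilator over [L] of the preimage [W] of [H] in [F^n]. If [x] annihilates [H],
    then [x G] annihilates [W], so [V :&: C] contains a copy of the annihilator of [H]. *)
Lemma subspace_dual (H : {vspace 'cV[L]_k}) :
  exists V : {vspace 'rV[L]_n}, [/\ theta_stable V,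
    (k <= \dim H + \dim (V :&: C))%N &
    (\dim V + \dim (restrict_scalars H :&: limg (colmap G)) = n)%N].
Proof.
pose W := (colmap G @^-1: restrict_scalars H)%VS.
have dimW : \dim W = \dim (restrict_scalars H :&: limg (colmap G)).
  rewrite -(limg_dim_eq (U := W) (f := colmap G)) ?(eqP injG) ?capv0 //.
  by rewrite /W -lpreim_cap_limg lpreimK ?capvSr.
rewrite -dimW; have [M WM freeM] := colvs_base W.
have [B HB freeB] := colvs_base H.
exists (rowvs (kermx (map_mx (in_alg L) M))); split.
- exact: theta_stable_annihilator.
- have rankB : \rank B = \dim H by rewrite -mxrank_tr (eqP freeB).
  suff : (\rank (kermx B *m G)
      <= \dim (rowvs (kermx (map_mx (in_alg L) M)) :&: C))%N.
    by rewrite mxrankMfree // mxrank_ker rankB leq_subLR.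
  rewrite CG rowvs_cap dim_rowvs mxrankS // sub_capmx submxMl andbT.
  rewrite sub_kermx -mulmxA; apply/eqP/matrixP => i j.
  have : col j M \in colvs M.
    by apply/colvsP; exists (delta_mx j 0); rewrite colE.
  rewrite -WM -memv_preim mem_restrict_scalars colmapE.
  have kerB x : x \in H -> kermx B *m x = 0.
    suff : x \in colvs B -> kermx B *m x = 0 by rewrite -HB.
    by move=> /colvsP[c ->]; rewrite mulmxA mulmx_ker mul0mx.
  move=> /kerB/colP/(_ i); rewrite map_col !colE !mulmxA -colE.
  by rewrite [LHS]mxE => ->; rewrite !mxE.
rewrite dim_rowvs mxrank_ker mxrank_map -mxrank_tr (eqP freeM).
by rewrite subnK ?dim_cV_le.
Qed.

End Duality.

(** The equation is over the integers because [(k - r) m] may exceed [n]. The dual [H] of a minimal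
    [V] always gives [n - d_r <= (k - r) m]; equality is what remains to be characterized. *)
Lemma gen_rank_weight_eqP n k (C : {vspace 'rV[L]_n}) (G : 'M[L]_(k, n)) r :
  C = rowvs G -> row_free G -> lker (colmap G) == 0%VS -> (r <= k)%N ->
  ((gen_rank_weight C r)%:Z = n%:Z - (k%:Z - r%:Z) * (\dim {:L})%:Z)
  <-> exists2 H, contained_in H (limg (colmap G)) & \dim H = (k - r)%N.
Proof.
move=> CG freeG injG le_rk; set m := \dim {:L}.
have m_gt0 : (0 < m)%N by apply: adim_gt0.
have rC : (r <= \dim C)%N by rewrite CG dim_rowvs (eqP freeG).
have [V [stV rV dimV]] := gen_rank_weight_attained rC.
have [H dimH leH] := stable_space_dual CG freeG injG stV.
have le_Vn := dim_rV_le V.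
have leHm := leq_trans leH (dimvS (capvSl _ _)).
rewrite dim_restrict_scalars -/m in leHm.
have le_Hm : (\dim H * m <= (k - r) * m)%N by rewrite leq_mul2r; lia.
split=> [weq|[H' cH' dimH']].
  (* The chain [n - d_r <= \dim (H :&: U) <= \dim H * m <= (k - r) m], dimensions over [F] in the
     second term, collapses to equalities. *)
  have eqH : (\dim H * m = (k - r) * m)%N by nia.
  exists H; last by apply/eqP; rewrite -(eqn_pmul2r m_gt0) eqH.
  apply/contained_inE/capv_idPl/eqP; rewrite eqEdim capvSl.
  by rewrite dim_restrict_scalars -/m; nia.
(* As [H'] lies in the system, its dual [V'] has dimension exactly [n - (k - r) m] and meets [C] in
   dimension at least [r]. *)
have [V' [stV' rV' dimV']] := subspace_dual CG freeG injG H'.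
have /capv_idPl capH' := iffLR (contained_inE _ _) cH'.
rewrite capH' dim_restrict_scalars -/m dimH' in dimV'.
have : (gen_rank_weight C r <= \dim V')%N.
  by apply: gen_rank_weight_le => //; lia.
by rewrite -dimV; nia.
Qed.

(** * The linearity index as an attained maximum, and the final equality *)

Lemma linearity_index_attained k (U : {vspace {ffun 'I_k -> L}}) :
  exists2 H, contained_in H U & \dim H = linearity_index U.
Proof.
apply: (@big_ind _ (fun d => exists2 H, contained_in H U & \dim H = d)).
- exists 0%VS; last exact: dimv0.
  move=> x; rewrite memv0 => /eqP ->.
  rewrite [X in X \in _](_ : _ = 0) ?mem0v //.
  by apply/ffunP => i; rewrite !ffunE mxE.
- by move=> d e Pd Pe; rewrite /maxn; case: ifP.
- by move=> d /asboolP.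
Qed.

Lemma linearity_index_ge k (H : {vspace 'cV[L]_k}) U :
  contained_in H U -> (\dim H <= linearity_index U)%N.
Proof.
move=> cH; have ltH : (\dim H < k.+1)%N by apply: dim_cV_le.
apply: (leq_bigmax_cond (Ordinal ltH)).
by apply/asboolP; exists H.
Qed.

End RankMetric.

Theorem lemma6p13 (F : finFieldType) (L : fieldExtType F) (n m k : nat)
    (hn : (0 < n)%N) (hm : (0 < m)%N) (hk : (0 < k)%N)
    (hL : \dim {:L} = m)
    (C : {vspace 'rV[L]_n}) (hC : \dim C = k) (ndC : rank_nondegenerate C)
    (U : {vspace {ffun 'I_k -> L}}) (hU : corresponding_system C U) :
  exists2 r : nat,
    is_least (fun r => (r <= k)%N /\
      (gen_rank_weight C r)%:Z = n%:Z - (k%:Z - r%:Z) * m%:Z) r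
    & linearity_index U = (k - r)%N.
Proof.
have [dimU _] := corresponding_systemP ndC hU.
have [G /andP[/eqP spanG _] UG] := hU.
have CG : C = rowvs G by rewrite -rowvs_span.
have freeG : row_free G by rewrite /row_free -dim_rowvs -CG hC.
rewrite -limg_colmap in UG.
(* Nondegeneracy gives [\dim U = n], so rank-nullity leaves a zero kernel. *)
have injG : lker (colmap G) == 0%VS.
  have := limg_ker_dim (colmap G) fullv; rewrite capfv -UG dimU dim_cV.
  by rewrite -dimv_eq0; lia.
have wP r := gen_rank_weight_eqP CG freeG injG (r := r).
rewrite hL -UG in wP.
have [H cH dimH] := linearity_index_attained U.
have leH : (linearity_index U <= k)%N by rewrite -dimH dim_cV_le.
(* By [wP], admissible [r] correspond to dimensions [k - r] of subspaces inside [U], so the least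
   [r] comes from the largest dimension. *)
exists (k - linearity_index U)%N; last by rewrite subKn.
split.
  split; first exact: leq_subr.
  by apply/wP; [exact: leq_subr | exists H; rewrite // subKn].
move=> s [le_sk /(wP _ le_sk)[H' cH' dimH']].
by have := linearity_index_ge cH'; lia.
Qed.
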